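(* (1) If $C_1,C_2$ are circuits of a matroid $M$ and there is an automorphism $\varphi$ of $M$ with $\varphi(C_1)=C_2$, then $\beta_{C_1}=\beta_{C_2}$. In particular, if the automorphism group of $M$ acts transitively on the set of circuits of $M$, then $M$ is equitable. (2) There exists an equitable matroid $M$ whose automorphism group does not act transitively on the set of circuits of $M$. (3) Uniform matroids and duals of projective geometries over finite fields are equitable.
   Context: Matroid bingo: let $M$ be a matroid on a finite set $E$ with $|E|=n$ and circuit set $\mathcal{C}$. The elements of $E$ are called out one at a time in a uniformly random order $\sigma(1),\sigma(2),\dots,\sigma(n)$ (a uniformly random permutation of $E$). A circuit $C$ wins in round $t$ if $C\subseteq\{\sigma(1),\dots,\sigma(t)\}$ and no circuit of $M$ is contained in $\{\sigma(1),\dots,\sigma(t-1)\}$; thus the winner is the first circuit to be completed (the circuit axioms guarantee that there is no tie). $\beta_C$ denotes the probability that $C$ wins (in some round). A matroid $M$ is equitable if all circuits $C$ of $M$ have the same value of $\beta_C$. An automorphism of $M$ is a bijection of the ground set that induces a bijection of the set of circuits onto itself. The uniform matroid $U_{r,n}$ is the matroid on $\{1,\dots,n\}$ whose circuits are all subsets of size $r+1$. For a prime power $q$ and an integer $n\ge 0$, the projective geometry $\mathrm{PG}(n,q)$ is the matroid of rank $n+1$ whose ground set is the set of 1-dimensional subspaces of $\mathrm{GF}(q)^{n+1}$, a set of such subspaces being independent if and only if they are linearly independent in $\mathrm{GF}(q)^{n+1}$. The dual matroid $M^*$ of a matroid $M$ on $E$ is the matroid on $E$ whose bases are the complements $E\setminus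 B$ of the bases $B$ of $M$. *)

(* Defs.v *)
(* MathComp *)
From HB Require Import structures.
From mathcomp Require Import all_boot all_order all_fingroup all_algebra.

Set Implicit Arguments.
Unset Strict Implicit.
Unset Printing Implicit Defensive.

Import GRing.Theory.

Record matroid (E : finType) := Matroid {
  indep : {set {set E}};
  indep0 : set0 \in indep;
  indepS : forall A B : {set E}, A \subset B -> B \in indep -> A \in indep;
  indep_aug : forall A B : {set E},
    A \in indep -> B \in indep -> #|A| < #|B| ->
    exists2 x, x \in B :\: A & x |: A \in indep
}.

Definition circuits (E : finType) (M : matroid E) : {set {set E}} :=
  [set C | minset (fun A => A \notin indep M) C].

Definition bases (E : finType) (M : matroid E) : {set {set E}} :=
  [set B | maxset (fun A => A \in indep M) B].

(* A calling order lists E without repetition; indices start at 0, so round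
   t.+1 calls the element of index t. *)
Definition orders (E : finType) : {set {ffun 'I_#|E| -> E}} :=
  [set s : {ffun 'I_#|E| -> E} | injectiveb s].

Definition called (E : finType) (s : {ffun 'I_#|E| -> E}) (t : nat) : {set E} :=
  [set s i | i : 'I_#|E| & i < t].

Definition wins_in_round (E : finType) (M : matroid E)
    (s : {ffun 'I_#|E| -> E}) (C : {set E}) (t : nat) : bool :=
  [&& C \in circuits M, C \subset called s t
    & [forall D in circuits M, ~~ (D \subset called s t.-1)]].

Definition wins (E : finType) (M : matroid E) (s : {ffun 'I_#|E| -> E})
    (C : {set E}) : bool :=
  [exists t : 'I_#|E|, wins_in_round M s C t.+1].

Definition beta (E : finType) (M : matroid E) (C : {set E}) : rat :=
  (#|[set s in orders E | wins M s C]|%:R / #|orders E|%:R)%R.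

Definition equitable (E : finType) (M : matroid E) : Prop :=
  forall C D : {set E}, C \in circuits M -> D \in circuits M ->
  beta M C = beta M D.

(* The induced map on subsets is injective, so equality of the image with
   [circuits M] means that it permutes the circuits. *)
Definition automorphism (E : finType) (M : matroid E) (f : {perm E}) : bool :=
  [set f @: C | C : {set E} in circuits M] == circuits M.

(* Not [transitive _, on circuits M | 'P^*], which fails on the empty set and
   so would make a matroid without circuits non-transitive. *)
Definition circuit_transitive (E : finType) (M : matroid E) : Prop :=
  forall C D : {set E}, C \in circuits M -> D \in circuits M ->
  exists2 f : {perm E}, automorphism M f & f @: C = D.

Section Uniform.

Variables r n : nat.

Let I : {set {set 'I_n}} := [set A : {set 'I_n} | #|A| <= r].

Fact uniform_indep0 : set0 \in I.
Proof. by rewrite inE cards0. Qed.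

Fact uniform_indepS (A B : {set 'I_n}) : A \subset B -> B \in I -> A \in I.
Proof. by rewrite !inE => /subset_leq_card; apply: leq_trans. Qed.

Fact uniform_indep_aug (A B : {set 'I_n}) :
  A \in I -> B \in I -> #|A| < #|B| -> exists2 x, x \in B :\: A & x |: A \in I.
Proof.
rewrite !inE => _ leBr ltAB.
have /subsetPn[x xB xA] : ~~ (B \subset A).
  by apply: contraTN ltAB => /subset_leq_card; rewrite -leqNgt.
by exists x; rewrite inE ?xA // cardsU1 xA (leq_trans ltAB).
Qed.

Definition uniform : matroid 'I_n :=
  Matroid uniform_indep0 uniform_indepS uniform_indep_aug.

Lemma circuits_uniform : circuits uniform = [set C : {set 'I_n} | #|C| == r.+1].
Proof.
apply/setP => C; rewrite !inE; apply/minsetP/eqP; rewrite inE -ltnNge.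
  case=> ltrC minC; apply/eqP; rewrite eqn_leq ltrC andbT leqNgt.
  apply/negP => lt1C; have /card_gt0P[x xC] : 0 < #|C| by apply: leq_trans lt1C.
  have /setP/(_ x) : C :\ x = C.
    apply: minC; last exact: subD1set.
    by rewrite inE -ltnNge; rewrite (cardsD1 x) xC in lt1C.
  by rewrite !inE eqxx xC.
move=> cardC; split=> [|D]; first by rewrite cardC.
rewrite inE -ltnNge => ltrD sDC.
by apply/eqP; rewrite eqEcard sDC cardC.
Qed.

End Uniform.

Section Dual.

Variables (E : finType) (M : matroid E).

Fact basesP (B : {set E}) :
  reflect (B \in indep M /\ forall A, A \in indep M -> #|A| <= #|B|)
          (B \in bases M).
Proof.
rewrite inE; apply: (iffP maxsetP) => -[iB maxB]; split=> // A iA.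
  rewrite leqNgt; apply/negP => /(indep_aug iB iA)[x].
  rewrite inE => /andP[xB _] ixB.
  have /setP/(_ x) := maxB _ ixB (subsetUr _ _).
  by rewrite !inE eqxx (negPf xB).
by move=> sBA; apply/eqP; rewrite eq_sym eqEcard sBA maxB.
Qed.

Fact bases_neq0 : exists B, B \in bases M.
Proof.
have [B maxB _] := @maxset_exists _ (fun A => A \in indep M) _ (indep0 M).
by exists B; rewrite inE.
Qed.

Fact bases_ext (A X B : {set E}) :
  A \in indep M -> A \subset X -> B \in bases M -> B \subset X ->
  exists2 B', B' \in bases M & (A \subset B') && (B' \subset X).
Proof.
move=> iA sAX /basesP[iB maxB] sBX.
pose P (S : {set E}) := (S \in indep M) && (S \subset X).
have [|B' /maxsetP[/andP[iB' sB'X] maxB'] sAB'] := @maxset_exists _ P A.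
  by rewrite /P iA.
exists B'; last by rewrite sAB'.
apply/basesP; split=> // S iS; apply: leq_trans (maxB _ iS) _.
rewrite leqNgt; apply/negP => /(indep_aug iB' iB)[x].
rewrite inE => /andP[xB' xB] ixB'.
have /setP/(_ x) : x |: B' = B'.
  by apply: maxB'; rewrite ?subsetUr // /P ixB' subUset sub1set (subsetP sBX).
by rewrite !inE eqxx (negPf xB').
Qed.

Let I : {set {set E}} := [set A : {set E} | [exists B in bases M, A \subset ~: B]].

Fact dual_indep0 : set0 \in I.
Proof.
have [B bB] := bases_neq0.
by rewrite inE; apply/exists_inP; exists B; rewrite ?sub0set.
Qed.

Fact dual_indepS (A B : {set E}) : A \subset B -> B \in I -> A \in I.
Proof.
rewrite !inE => sAB /exists_inP[S bS sBS]; apply/exists_inP; exists S => //.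
exact: subset_trans sBS.
Qed.

Fact dual_indep_aug (A A' : {set E}) :
  A \in I -> A' \in I -> #|A| < #|A'| ->
  exists2 x, x \in A' :\: A & x |: A \in I.
Proof.
rewrite !inE => /exists_inP[B bB sAB] /exists_inP[B' bB' sA'B'] ltAA'.
have [iB' maxB'] := basesP _ bB'.
have iB'A : B' :\: A \in indep M by apply: indepS iB'; apply: subsetDl.
have sB'A : B' :\: A \subset ~: A by rewrite setDE subsetIr.
have sBA : B \subset ~: A by rewrite subsetC.
have [S bS /andP[sB'S sSA]] := bases_ext iB'A sB'A bB sBA.
have [/subsetP sub | /subsetPn[x xA'A xS]] := boolP (A' :\: A \subset S).
  have /basesP[iS _] := bS; have := maxB' _ iS; rewrite leqNgt => /negP[].
  apply: (@leq_trans #|(A' :\: A) :|: (B' :\: A)|); last first.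
    by apply/subset_leq_card; rewrite subUset sB'S andbT; apply/subsetP.
  have -> : #|(A' :\: A) :|: (B' :\: A)| = #|A' :\: A| + #|B' :\: A|.
    rewrite cardsU [_ :&: _](_ : _ = set0) ?cards0 ?subn0 //.
    apply/eqP; rewrite -subset0; apply/subsetP => y; rewrite !inE => /andP[/andP[_ yA'] /andP[_ yB']].
    by have := subsetP sA'B' _ yA'; rewrite inE yB'.
  rewrite -(cardsID A B') ltn_add2r.
  have : #|A :\: A'| < #|A' :\: A|.
    by move: ltAA'; rewrite -(cardsID A' A) -(cardsID A A') setIC ltn_add2l.
  apply: leq_ltn_trans; apply/subset_leq_card/subsetP => y.
  rewrite !inE => /andP[yB' yA]; rewrite yA andbT.
  by apply/negP => /(subsetP sA'B'); rewrite inE yB'.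
exists x => //; rewrite inE; apply/exists_inP; exists S => //.
by rewrite subUset sub1set inE xS subsetC.
Qed.

Definition dual : matroid E := Matroid dual_indep0 dual_indepS dual_indep_aug.

Lemma bases_dual : bases dual = [set ~: B | B in bases M].
Proof.
apply/setP => S; rewrite inE; apply/maxsetP/imsetP.
  rewrite inE => -[/exists_inP[B bB sSB] maxS]; exists B => //.
  by apply/esym/maxS => //; rewrite inE; apply/exists_inP; exists B.
case=> B bB ->; split; first by rewrite inE; apply/exists_inP; exists B.
move=> A; rewrite inE => /exists_inP[B' bB' sAB'] sBA.
have /basesP[_ maxB] := bB; have /basesP[iB' _] := bB'.
apply/eqP; rewrite eq_sym eqEcard sBA (leq_trans (subset_leq_card sAB')) //.
have sB'B : B' \subset B by rewrite -setCS (subset_trans sBA).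
have /basesP[_ maxB'] := bB'; have /basesP[iB _] := bB.
have -> // : B' = B by apply/eqP; rewrite eqEcard sB'B maxB'.
Qed.

End Dual.

HB.instance Definition _ (F : finFieldType) (vT : vectType F) :=
  CanIsCountable (@VectorInternalTheory.vs2mxK F vT).
HB.instance Definition _ (F : finFieldType) (vT : vectType F) :
    isFinite {vspace vT} :=
  CanIsFinite (@VectorInternalTheory.vs2mxK F vT).

Section ProjectiveGeometry.

Variables (n : nat) (F : finFieldType).

Definition pg_point := {U : {vspace 'rV[F]_n.+1} | \dim U == 1}.

(* Lines are linearly independent when nonzero representatives are; the
   choice of representatives is irrelevant by [pg_indepE]. *)
Definition pg_reps (A : {set pg_point}) : seq 'rV[F]_n.+1 :=
  [seq vpick (val U) | U <- enum A].

Definition pg_indep : {set {set pg_point}} := [set A | free (pg_reps A)].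

Fact pg_line (U : pg_point) (v : 'rV[F]_n.+1) :
  v \in val U -> v != 0%R -> <[v]>%VS = val U.
Proof.
move=> vU v0; apply/eqP.
by rewrite eqEdim -memvE vU (eqP (valP U)) dim_vline v0.
Qed.

Fact pg_vpick_neq0 (U : pg_point) : vpick (val U) != 0%R.
Proof. by rewrite vpick0 -dimv_eq0 (eqP (valP U)). Qed.

Lemma pg_indepE (A : {set pg_point}) (v : pg_point -> 'rV[F]_n.+1) :
  (forall U, U \in A -> v U \in val U) -> (forall U, U \in A -> v U != 0%R) ->
  (A \in pg_indep) = free [seq v U | U <- enum A].
Proof.
move=> vU v0; rewrite inE /free !size_map; congr (\dim _ == _).
rewrite !span_def !big_map !big_enum /=; apply: eq_bigr => U UA.
by rewrite !(@pg_line U) ?memv_pick ?pg_vpick_neq0 ?vU ?v0.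
Qed.

Fact pg_indep0 : set0 \in pg_indep.
Proof. by rewrite inE /pg_reps enum_set0 nil_free. Qed.

Fact pg_indepS (A B : {set pg_point}) :
  A \subset B -> B \in pg_indep -> A \in pg_indep.
Proof.
rewrite !inE => sAB fB; apply: (@catl_free _ _ (pg_reps (B :\: A))).
suff /perm_free<- : perm_eq (pg_reps B) (pg_reps A ++ pg_reps (B :\: A)) by [].
rewrite /pg_reps -map_cat; apply/perm_map/uniq_perm; rewrite ?enum_uniq //.
  rewrite cat_uniq !enum_uniq andbT /=; apply/hasPn => U.
  by rewrite !mem_enum inE => /andP[].
move=> U; rewrite mem_cat !mem_enum !inE.
by case: (boolP (U \in A)) => // /(subsetP sAB).
Qed.

Fact pg_indep_aug (A B : {set pg_point}) :
  A \in pg_indep -> B \in pg_indep -> #|A| < #|B| ->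
  exists2 U, U \in B :\: A & U |: A \in pg_indep.
Proof.
rewrite !inE => fA fB ltAB.
have /hasP[U UB UA] : has [pred U | vpick (val U) \notin <<pg_reps A>>%VS] (enum B).
  apply: contraTT ltAB => /hasPn allB; rewrite -leqNgt.
  have := fA; have := fB; rewrite /free !size_map -!cardE.
  move=> /eqP<- /eqP<-; apply/dimvS/span_subvP => v /mapP[U UB ->].
  by have := allB _ UB; rewrite /= negbK.
have UnA : U \notin A.
  apply: contra UA => UA; apply: memv_span.
  by apply: map_f; rewrite mem_enum.
exists U; first by rewrite inE UnA -mem_enum.
rewrite inE.
have /perm_free-> : perm_eq (pg_reps (U |: A)) (vpick (val U) :: pg_reps A).
  apply: (perm_map _ (_ : perm_eq _ (U :: enum A))).
  apply: uniq_perm; rewrite ?enum_uniq //=.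
    by rewrite mem_enum UnA enum_uniq.
  by move=> V; rewrite inE !mem_enum !inE.
by rewrite free_cons fA andbT.
Qed.

Definition PG : matroid pg_point := Matroid pg_indep0 pg_indepS pg_indep_aug.

End ProjectiveGeometry.

(* Main.v *)
Require Import Defs.
From mathcomp Require Import all_boot all_order all_fingroup all_algebra.

(* Relabelling the calls by an automorphism permutes the orders and turns wins
   of C into wins of its image; this gives (1), and (3) follows since the
   symmetric group is transitive on the circuits of a uniform matroid and the
   linear group is transitive on hyperplanes, whose complements are the circuits
   of the dual of a projective geometry.

   For (2), take the direct sum of U_{4,6} and U_{8,9}.  The 9-circuit wins iff
   the last two calls both fall in the block of size 6, which has probability
   (6 * 5) / (15 * 14) = 1/7.  As every order has exactly one winner, the six
   5-circuits, which are exchanged by transpositions, share the remaining 6/7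
   equally; no automorphism maps a 5-circuit to the 9-circuit. *)

Set Implicit Arguments.
Unset Strict Implicit.
Unset Printing Implicit Defensive.

Import GRing.Theory.

(** * Images of subsets under permutations *)

Lemma inj_imsetSS (T T' : finType) (f : T -> T') (A B : {set T}) :
  injective f -> (f @: A \subset f @: B) = (A \subset B).
Proof.
move=> f_inj; apply/idP/idP => [/subsetP sAB|]; last exact: imsetS.
by apply/subsetP => x xA; rewrite -(mem_imset _ _ f_inj) sAB ?imset_f.
Qed.

Lemma imset_permC (T : finType) (f : {perm T}) (A : {set T}) :
  f @: (~: A) = ~: (f @: A).
Proof.
apply/setP => x; rewrite -[x](permKV f) inE !mem_imset ?inE //; exact: perm_inj.
Qed.

Lemma imset_permK (T : finType) (f : {perm T}) (A : {set T}) :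
  f @: (f^-1%g @: A) = A.
Proof.
by rewrite -imset_comp -[RHS]imset_id; apply: eq_imset => x /=; rewrite permKV.
Qed.

Lemma tperm_imset (T : finType) (x y : T) (A : {set T}) :
  x \in A -> y \notin A -> tperm x y @: A = y |: A :\ x.
Proof.
move=> xA yA; apply/setP => z; rewrite -{1}[z](tpermK x y).
rewrite mem_imset; last exact: perm_inj.
rewrite !inE; case: tpermP => [->|->|/eqP/negPf-> /eqP/negPf-> //].
  by rewrite eqxx orbF; case: eqP yA => [<-|_ /negPf->//]; rewrite xA.
by rewrite xA eqxx.
Qed.

(** Induction on [#|A :\: B|]: transposing a point of [A :\: B] with one of [B :\: A] lowers it and
    keeps the size of [A]. *)
Lemma perm_imset_eqcard (T : finType) (A B : {set T}) :
  #|A| = #|B| -> exists f : {perm T}, f @: A = B.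
Proof.
have [k le_k] := ubnP #|A :\: B|; elim: k => // k IHk in A le_k *.
move=> eqAB; have [AB0 | [x]] := set_0Vmem (A :\: B).
  exists 1%g; have -> : (1%g : {perm T}) @: A = A.
    by rewrite -[RHS]imset_id; apply: eq_imset => x; rewrite perm1.
  by apply/eqP; rewrite eqEcard eqAB leqnn andbT -setD_eq0 AB0.
rewrite inE => /andP[xB xA]; have /subsetPn[y yB yA] : ~~ (B \subset A).
  apply: contra xB => sBA; have /eqP-> // : B == A.
  by rewrite eqEcard sBA eqAB /=.
have [||f fAB] := IHk (tperm x y @: A).
- rewrite ltnS in le_k; apply: leq_trans le_k.
  rewrite [#|A :\: B|](cardsD1 x) inE xB xA.
  rewrite ltnS tperm_imset //; apply/subset_leq_card/subsetP => z.
  by rewrite !inE => /andP[zB /orP[/eqP zy|/andP[-> ->]]];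
    [rewrite zy yB in zB | rewrite zB].
- by rewrite card_imset //; apply: perm_inj.
exists (tperm x y * f)%g; rewrite -fAB -imset_comp.
by apply: eq_imset => z; rewrite permM.
Qed.

(** * Relabelled orders and the action of automorphisms on wins *)

Section Relabelling.

Variables (E : finType) (f : {perm E}).

Definition relabel (s : {ffun 'I_#|E| -> E}) : {ffun 'I_#|E| -> E} :=
  [ffun i => f (s i)].

Lemma relabel_inj : injective relabel.
Proof.
move=> s s' /ffunP eq_s; apply/ffunP => i.
by have := eq_s i; rewrite !ffunE => /perm_inj.
Qed.

Lemma relabel_orders s : (relabel s \in orders E) = (s \in orders E).
Proof.
rewrite !inE; apply/injectiveP/injectiveP => s_inj i j.
  by move=> eq_s; apply: s_inj; rewrite !ffunE eq_s.
by rewrite !ffunE => /perm_inj/s_inj.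
Qed.

Lemma called_relabel s t : called (relabel s) t = f @: called s t.
Proof. by rewrite -imset_comp; apply: eq_imset => i; rewrite /= ffunE. Qed.

(** An injective self-map of a finite set is a bijection, and this one preserves [orders]. *)
Lemma card_relabel (P : pred {ffun 'I_#|E| -> E}) :
  #|[set s in orders E | P (relabel s)]| = #|[set s in orders E | P s]|.
Proof.
rewrite -[RHS](card_preimset _ relabel_inj); apply: eq_card => s.
by have := relabel_orders s; rewrite !inE => ->.
Qed.

End Relabelling.

Section Automorphisms.

Variables (E : finType) (M : matroid E) (f : {perm E}).

Lemma automorphism_circuit : automorphism M f ->
  forall C : {set E}, (f @: C \in circuits M) = (C \in circuits M).
Proof.
by move=> autf C; rewrite -{1}(eqP autf) mem_imset //; apply/imset_inj/perm_inj.
Qed.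

(** [relabel] commutes with [called], and the condition that no circuit is complete can be tested on
    images, since every circuit is the image of a circuit. *)
Lemma wins_relabel : automorphism M f ->
  forall s (C : {set E}), wins M (relabel f s) (f @: C) = wins M s C.
Proof.
move=> autf s C; apply: eq_existsb => t; rewrite /wins_in_round !called_relabel.
have sub (A B : {set E}) : (f @: A \subset f @: B) = (A \subset B).
  exact/inj_imsetSS/perm_inj.
rewrite automorphism_circuit // sub; congr [&& _, _ & _].
apply/forall_inP/forall_inP => noD D cD.
  by rewrite -sub noD // automorphism_circuit.
by move: cD; rewrite -{1}(eqP autf) => /imsetP[D' cD' ->]; rewrite sub noD.
Qed.

Lemma card_wins_automorphism : automorphism M f -> forall C : {set E},
  #|[set s in orders E | wins M s (f @: C)]| = #|[set s in orders E | wins M s C]|.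
Proof.
move=> autf C; rewrite -(card_relabel f).
by under eq_finset => s do rewrite wins_relabel //.
Qed.

(** Minimal dependent sets go to minimal dependent sets; since taking images is injective on
    subsets, this inclusion is an equality by counting. *)
Lemma indep_automorphism :
  (forall A : {set E}, (f @: A \in indep M) = (A \in indep M)) -> automorphism M f.
Proof.
move=> indepf; rewrite /automorphism eqEcard card_imset; last first.
  exact/imset_inj/perm_inj.
rewrite leqnn andbT; apply/subsetP => _ /imsetP[C cC ->].
move: cC; rewrite !inE => /minsetP[dC minC]; apply/minsetP; rewrite indepf.
split=> // B dB sBC; rewrite -(imset_permK f B) (minC (f^-1%g @: B)) //.
  by rewrite -indepf imset_permK.
by rewrite -(@inj_imsetSS _ _ f) ?imset_permK //; apply: perm_inj.
Qed.

End Automorphisms.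

Lemma circuit_transitive_equitable (E : finType) (M : matroid E) :
  circuit_transitive M -> equitable M.
Proof.
move=> trM C D cC cD; have [f autf <-] := trM C D cC cD.
by rewrite /beta card_wins_automorphism.
Qed.

Lemma uniform_circuit_transitive r n : circuit_transitive (uniform r n).
Proof.
move=> C D; rewrite !circuits_uniform !inE => /eqP cardC /eqP cardD.
have [|f fC] := @perm_imset_eqcard _ C D; first by rewrite cardC.
exists f => //; apply: indep_automorphism => A.
by rewrite !inE card_imset //; apply: perm_inj.
Qed.

(** Bases are the independent sets of largest size and [f] preserves sizes, so it permutes bases;
    images also commute with complements. *)
Lemma dual_indep_perm (E : finType) (M : matroid E) (f : {perm E}) :
  (forall A : {set E}, (f @: A \in indep M) = (A \in indep M)) ->
  forall A : {set E}, (f @: A \in indep (dual M)) = (A \in indep (dual M)).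
Proof.
move=> indepf; have basesf (B : {set E}) : (f @: B \in bases M) = (B \in bases M).
  by apply/basesP/basesP; rewrite indepf (card_imset _ (@perm_inj _ f)).
move=> A; rewrite !inE; apply/exists_inP/exists_inP => -[B bB sAB].
  exists (f^-1%g @: B); first by rewrite -basesf imset_permK.
  rewrite -(@inj_imsetSS _ _ f); last exact: perm_inj.
  by rewrite imset_permC imset_permK.
exists (f @: B); first by rewrite basesf.
by rewrite -imset_permC inj_imsetSS //; apply: perm_inj.
Qed.

(** * Hyperplanes and linear automorphisms *)

Section LinearAlgebra.

Local Open Scope vspace_scope.

Variables (K : fieldType) (vT : vectType K).

Lemma exists_hyperplane (U : {vspace vT}) : U != fullv ->
  exists2 W : {vspace vT}, U <= W & (\dim W).+1 = \dim {: vT}.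
Proof.
move=> ltU; have C0 : U^C != 0.
  by apply: contraNneq ltU => C0; rewrite -(addv_complf U) C0 addv0.
pose v := vpick U^C; have vC : v \in U^C := memv_pick _.
have v0 : v != 0%R by rewrite vpick0.
(* Removing the line of [v] from the complement of [U] costs exactly one dimension. *)
exists (U + (U^C :\: <[v]>)); first exact: addvSl.
rewrite dimv_disjoint_sum; last first.
  by apply/eqP; rewrite -subv0 -(capv_compl U) capvS // diffvSl.
have := dimv_cap_compl U^C <[v]>; rewrite (capv_idPr _) -?memvE //.
rewrite dim_vline v0 => dimC; rewrite -addnS -[(_ (_ :\: _)).+1]add1n dimC.
by rewrite -dimv_disjoint_sum ?addv_complf // capv_compl.
Qed.

(** A basis of each subspace, followed by a basis of a complement, is a basis of the whole space;
    [f] carries the first such basis to the second. It is then onto, hence injective by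
    rank-nullity. *)
Lemma exists_limg_eqdim (U W : {vspace vT}) : \dim U = \dim W ->
  exists2 f : 'End(vT), lker f == 0 & f @: U = W.
Proof.
move=> eqUW; pose basis (V : {vspace vT}) := vbasis V ++ vbasis V^C.
have span_full V : <<basis V>> = fullv :> {vspace vT}.
  by rewrite span_cat !(span_basis (vbasisP _)) addv_complf.
have free_basis V : free (basis V).
  rewrite /free span_full size_cat !size_tuple.
  by rewrite -dimv_disjoint_sum ?addv_complf // capv_compl.
have [f fP] := linear_of_free (basis U) (basis W).
have {fP} fUW : map (linfun f) (basis U) = basis W.
  rewrite -fP //; first by apply: eq_map => x; rewrite lfunE.
  by rewrite !size_cat !size_tuple !dimv_compl eqUW.
exists (linfun f).
  have limg_full : limg (linfun f) = fullv.
    by rewrite -[X in (_ @: X)%VS](span_full U) limg_span fUW span_full.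
  have /eqP := limg_ker_dim (linfun f) fullv.
  by rewrite limg_full capfv -[X in _ == X]add0n eqn_add2r dimv_eq0.
have /eqP := fUW; rewrite map_cat eqseq_cat; last first.
  by rewrite size_map !size_tuple.
case/andP=> /eqP fU _; rewrite -[in LHS](span_basis (vbasisP U)).
by rewrite limg_span fU (span_basis (vbasisP W)).
Qed.

End LinearAlgebra.

(** * Circuits of the dual of a projective geometry *)

Section DualProjectiveGeometry.

Local Open Scope vspace_scope.

Variables (n : nat) (F : finFieldType).

Local Notation point := (pg_point n F).
Local Notation PG := (PG n F).

Implicit Types (U : point) (A B C : {set point}) (W : {vspace 'rV[F]_n.+1}).

Lemma pg_vlineE U : <[vpick (val U)]> = val U.
Proof. by rewrite (@pg_line _ _ U) ?memv_pick ?pg_vpick_neq0. Qed.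

(** Frees the span from the chosen representatives: only the lines themselves matter. *)
Lemma pg_spanP A W :
  reflect (forall U, U \in A -> val U <= W) (<<pg_reps A>> <= W).
Proof.
apply: (iffP span_subvP) => [sAW U UA|sAW _ /mapP[U UA ->]].
  by rewrite -pg_vlineE -memvE; apply/sAW/map_f; rewrite mem_enum.
by rewrite memvE pg_vlineE sAW // -mem_enum.
Qed.

Lemma pg_reps_setU1 U A : U \notin A ->
  perm_eq (pg_reps (U |: A)) (vpick (val U) :: pg_reps A).
Proof.
move=> UA; apply: (perm_map _ (_ : perm_eq _ (U :: enum A))).
apply: uniq_perm; rewrite ?enum_uniq //=; first by rewrite mem_enum UA enum_uniq.
by move=> V; rewrite inE !mem_enum !inE.
Qed.

Lemma pg_indep_setU1 U A : A \in indep PG -> ~~ (val U <= <<pg_reps A>>) ->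
  U \notin A /\ U |: A \in indep PG.
Proof.
move=> iA UA; have UnA : U \notin A.
  by apply: contra UA => UA; have /pg_spanP-> := subvv <<pg_reps A>>.
move: iA; rewrite !inE => fA.
by rewrite (perm_free (pg_reps_setU1 UnA)) free_cons memvE pg_vlineE UA.
Qed.

Lemma pg_point_notin W : W != fullv -> exists U, ~~ (val U <= W).
Proof.
rewrite eqEsubv subvf /= => /subvPn[v _ vW].
have v0 : v != 0%R by apply: contraNneq vW => ->; rewrite mem0v.
have dim_v : \dim <[v]> == 1%N by rewrite dim_vline v0.
by exists (Sub <[v]> dim_v); rewrite SubK -memvE.
Qed.

Lemma pg_card_indep A : A \in indep PG -> \dim <<pg_reps A>> = #|A|.
Proof. by rewrite inE /free size_map -cardE => /eqP. Qed.

(** An independent set that does not span can be enlarged by a point off its span; one that spans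
    has as many points as the dimension, which bounds every independent set. *)
Lemma pg_basesE B :
  (B \in bases PG) = (B \in indep PG) && (<<pg_reps B>> == fullv).
Proof.
apply/basesP/andP => -[iB].
  move=> maxB; split=> //; apply: contraT => /pg_point_notin[U UB].
  have [UnB iUB] := pg_indep_setU1 iB UB.
  by have := maxB _ iUB; rewrite cardsU1 UnB ltnn.
move=> /eqP fullB; split=> // A iA.
by rewrite -!pg_card_indep // fullB dimvS // subvf.
Qed.

Lemma pg_exists_basis A : <<pg_reps A>> = fullv ->
  exists2 B, B \in bases PG & B \subset A.
Proof.
move=> fullA; pose P B := (B \in indep PG) && (B \subset A).
have [|B /maxsetP[/andP[iB sBA] maxB] _] := @maxset_exists _ P set0.
  by rewrite /P indep0 sub0set.
exists B; rewrite // pg_basesE iB eqEsubv subvf -fullA.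
apply/pg_spanP => U UA; apply: contraT => UB.
have [UnB iUB] := pg_indep_setU1 iB UB.
have /setP/(_ U) : U |: B = B.
  by apply: maxB; rewrite ?subsetUr // /P iUB subUset sub1set UA.
by rewrite !inE eqxx (negPf UnB).
Qed.

(** A set is dependent in the dual iff it meets every basis. The complement of [C] thus contains no
    basis, does not span, and lies in a hyperplane [W]. The points off [W] still meet every basis,
    so minimality of [C] forces equality. *)
Lemma circuit_dual_PG C : C \in circuits (dual PG) ->
  exists2 W, \dim W = n & C = [set U | ~~ (val U <= W)].
Proof.
rewrite inE => /minsetP[dC minC].
have spanC : <<pg_reps (~: C)>> != fullv.
  apply: contra dC => /eqP/pg_exists_basis[B bB sBC].
  by rewrite inE; apply/exists_inP; exists B; rewrite // subsetC.
have [W sCW dimW] := exists_hyperplane spanC.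
exists W; first by have := dimW; rewrite dimvf /dim /= mul1n => -[].
apply/esym/minC; last first.
  apply/subsetP => U; rewrite inE; apply: contraNT => UC.
  by have /pg_spanP-> := sCW; rewrite ?inE.
rewrite inE; apply/exists_inP => -[B bB /subsetP sB].
have /andP[_ /eqP fullB] : (B \in indep PG) && (<<pg_reps B>> == fullv).
  by rewrite -pg_basesE.
have : fullv <= W.
  rewrite -fullB; apply/pg_spanP => U UB; apply: contraT => UW.
  by have := sB U; rewrite !inE UW UB => /(_ isT).
by move=> /dimvS; rewrite -dimW ltnn.
Qed.

Section Collineation.

Variables (f : 'End('rV[F]_n.+1)) (f_inj : lker f == 0).

Fact collineation_dim U : \dim (f @: val U) == 1%N.
Proof. by rewrite limg_dim_eq ?(valP U) // (eqP f_inj) capv0. Qed.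

Definition collineation_fun U : point := Sub (f @: val U) (collineation_dim U).

Fact collineation_inj : injective collineation_fun.
Proof.
by move=> U V /(congr1 val)/eqP; rewrite !SubK eq_limg_ker0 // => /eqP/val_inj.
Qed.

Definition collineation : {perm point} := perm collineation_inj.

Lemma val_collineation U : val (collineation U) = f @: val U.
Proof. by rewrite permE SubK. Qed.

Lemma collineation_indep A :
  ((collineation @: A)%SET \in indep PG) = (A \in indep PG).
Proof.
(* Representatives of the image points are taken to be the [f]-images of the original ones;
   [pg_indepE] allows this choice, and an injective [f] preserves the dimension of the span. *)
set g := collineation; pose v V := f (vpick (val (g^-1%g V))).
rewrite (@pg_indepE _ _ _ v) => [|V _|V _].
- have /perm_free-> : perm_eq [seq v V | V <- enum (g @: A)%SET] (map f (pg_reps A)).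
    rewrite -map_comp [X in perm_eq _ X](_ : _ = map v (map g (enum A))).
      apply/perm_map/uniq_perm; rewrite ?map_inj_uniq ?enum_uniq //.
        exact: perm_inj.
      move=> V; rewrite mem_enum; apply/imsetP/mapP => -[U UA ->]; exists U => //.
        by rewrite mem_enum.
      by rewrite -mem_enum.
    by rewrite -map_comp; apply: eq_map => U; rewrite /v /= permK.
  rewrite [RHS]inE /free -limg_span size_map.
  by rewrite limg_dim_eq // (eqP f_inj) capv0.
- by rewrite -[in val V](permKV g V) val_collineation memv_img ?memv_pick.
- rewrite -(linear0 f); apply: contra (pg_vpick_neq0 (g^-1%g V)).
  by move=> /eqP/(lker0P f_inj)->.
Qed.

End Collineation.

Lemma dual_PG_circuit_transitive : circuit_transitive (dual PG).
Proof.
move=> _ _ /circuit_dual_PG[W1 dimW1 ->] /circuit_dual_PG[W2 dimW2 ->].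
have [|f f_inj fW] := @exists_limg_eqdim _ _ W1 W2; first by rewrite dimW1.
exists (collineation f_inj).
  exact/indep_automorphism/dual_indep_perm/collineation_indep.
apply/setP => U; rewrite -[U](permKV (collineation f_inj)).
rewrite mem_imset ?inE; last exact: perm_inj.
by rewrite val_collineation -fW limg_ker0.
Qed.

End DualProjectiveGeometry.

(** * Existence and uniqueness of the winner *)

Section Winner.

Variables (E : finType) (M : matroid E).

Implicit Types (A C D : {set E}) (s : {ffun 'I_#|E| -> E}).

(** Independence is hereditary, so minimality need only be tested by deleting single elements. *)
Lemma circuitP C :
  reflect (C \notin indep M /\ forall x, x \in C -> C :\ x \in indep M)
          (C \in circuits M).
Proof.
rewrite inE; apply: (iffP minsetP) => -[dC minC]; split=> //.
  move=> x xC; apply: contraT => dCx; have /setP/(_ x) := minC _ dCx (subD1set _ _).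
  by rewrite !inE eqxx xC.
move=> A dA sAC; apply/eqP; rewrite eqEsubset sAC; apply/subsetP => x xC.
apply: contraNT dA => xA; apply: indepS (minC x xC).
by rewrite subsetD1 sAC.
Qed.

Lemma dep_circuit A :
  (A \notin indep M) = [exists C in circuits M, C \subset A].
Proof.
apply/idP/exists_inP => [dA | [C /circuitP[dC _] sCA]].
  have [C minC sCA] := minset_exists (P := fun A => A \notin indep M) dA.
  by exists C; rewrite // inE.
by apply: contra dC; apply: indepS.
Qed.

(* Augment a maximal independent subset of [C :|: D] that contains [C :\ y]:
   it misses [y] and a point of [D], whereas [A] misses [x] only. *)
Lemma circuit_unique A x C D : A \in indep M ->
  C \in circuits M -> D \in circuits M ->
  C \subset x |: A -> D \subset x |: A -> C = D.
Proof.
move=> iA cC cD sC sD.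
have [dC minC] := circuitP _ cC; have [dD minD] := circuitP _ cD.
have xin (B : {set E}) : B \subset x |: A -> B \notin indep M -> x \in B.
  move=> sB; apply: contraR => xB; apply: indepS iA.
  apply/subsetP => z zB; have := subsetP sB z zB; rewrite !inE.
  by case: eqP => // zx; rewrite zx (negPf xB) in zB.
apply/eqP; rewrite eqEsubset; have [sCD|/subsetPn[y yC yD]] := boolP (C \subset D).
  apply: contraR dC => nsDC.
  have /subsetPn[z zD zC] := nsDC; apply: indepS (minD z zD).
  by rewrite subsetD1 sCD.
exfalso; pose P (I : {set E}) := (I \in indep M) && (I \subset C :|: D).
have [|I /maxsetP[/andP[iI sI] maxI] sCI] := @maxset_exists _ P (C :\ y).
  rewrite /P minC // (subset_trans (subD1set _ _)) //; exact: subsetUl.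
have yI : y \notin I.
  apply: contra dC => yI; apply: indepS iI; rewrite -(setD1K yC).
  by rewrite subUset sub1set yI.
have /subsetPn[z zD zI] : ~~ (D \subset I).
  by apply: contra dD => sDI; apply: indepS iI.
have iCDx : (C :|: D) :\ x \in indep M.
  by apply: indepS iA; rewrite subDset subUset sC.
have [|u] := indep_aug iI iCDx; last first.
  rewrite !inE => /andP[uI /andP[_ uCD]] iuI.
  have /setP/(_ u) : u |: I = I.
    apply: maxI; rewrite ?subsetUr // /P iuI subUset sub1set inE uCD.
    exact: sI.
  by rewrite !inE eqxx (negPf uI).
have xCD : x \in C :|: D by rewrite inE xin.
rewrite -ltnS -[in X in _ < X]add1n -[X in _ < X](_ : #|C :|: D| = _); last first.
  by rewrite (cardsD1 x) xCD.
apply: (@leq_trans #|y |: (z |: I)|).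
  rewrite !cardsU1 !inE (negPf zI) (negPf yI) orbF /=.
  by case: eqP zD yD => // <- ->.
apply: subset_leq_card; rewrite !subUset !sub1set !inE yC zD orbT sI.
by [].
Qed.

(** Neither circuit can be complete before the other wins, so the rounds agree. The calls before
    that round form an independent set, and both circuits lie in it with one element added, so
    [circuit_unique] applies. *)
Lemma wins_unique s C D : wins M s C -> wins M s D -> C = D.
Proof.
move=> /existsP[t /and3P[cC sC noC]] /existsP[u /and3P[cD sD noD]].
have le_called i j : i <= j -> called s i \subset called s j.
  move=> le_ij; apply/imsetS/subsetP => k; rewrite !inE => /leq_trans; exact.
have leq_round (i j : nat) A : A \in circuits M -> A \subset called s i.+1 ->
    [forall D in circuits M, ~~ (D \subset called s j)] -> j <= i.
  move=> cA sA /forall_inP/(_ _ cA); rewrite leqNgt; apply: contra => lt_ij.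
  exact: subset_trans sA (le_called _ _ lt_ij).
have eq_tu : t = u.
  apply/val_inj/eqP; rewrite eqn_leq.
  by rewrite (leq_round _ _ _ cD sD noC) (leq_round _ _ _ cC sC noD).
have calledS : called s t.+1 \subset s t |: called s t.
  apply/subsetP => _ /imsetP[k /[!inE] lt_kt ->].
  move: lt_kt; rewrite ltnS leq_eqVlt => /predU1P[/val_inj->|lt_kt].
    by rewrite eqxx.
  by rewrite imset_f ?orbT // inE.
apply: (@circuit_unique (called s t) (s t)) => //.
- apply: contraT; rewrite dep_circuit => /exists_inP[B cB].
  by apply/contraLR => _; apply: (forall_inP noC).
- exact: subset_trans calledS.
- by rewrite -eq_tu in sD; exact: subset_trans calledS.
Qed.

(** All elements are called in the end, so a least number of calls containing a circuit exists. It
    is positive because the empty set is independent, so it is the number of a round. *)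
Lemma wins_exists s : s \in orders E -> circuits M != set0 ->
  exists C, wins M s C.
Proof.
rewrite inE => /injectiveP s_inj /set0Pn[C0 cC0].
pose P t := [exists C in circuits M, C \subset called s t].
have P0 : P 0 = false.
  apply/negbTE; rewrite /P -dep_circuit negbK; apply: indepS (indep0 M).
  by apply/subsetP => x /imsetP[i]; rewrite inE.
have Pn : P #|E|.
  apply/exists_inP; exists C0 => //; apply/subsetP => x _.
  have /codomP[i ->] : x \in codom s by apply: inj_card_onto; rewrite ?card_ord.
  by apply: imset_f; rewrite inE.
have [t Pt minP] := ex_minnP (ex_intro P _ Pn).
case: t Pt minP => [|t] Pt minP; first by rewrite P0 in Pt.
have lt_tE : t < #|E| := minP _ Pn.
have /exists_inP[C cC sC] := Pt; exists C; apply/existsP; exists (Ordinal lt_tE).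
rewrite /wins_in_round cC sC; apply/forall_inP => D cD; apply/negP => sD.
by have /minP : P t; [apply/exists_inP; exists D | rewrite ltnn].
Qed.

(** Double counting: each order contributes to exactly one summand. *)
Lemma sum_wins : circuits M != set0 ->
  \sum_(C in circuits M) #|[set s in orders E | wins M s C]| = #|orders E|.
Proof.
move=> c0; under eq_bigr => C _ do rewrite -sum1dep_card big_mkcondr.
rewrite exchange_big -[RHS]sum1_card /=; apply: eq_bigr => s sE.
have [C wC] := wins_exists sE c0.
have cC : C \in circuits M by have /existsP[t /and3P[]] := wC.
rewrite (bigD1 C) //= wC big1 ?addn0 // => D /andP[_ neqDC].
by case: ifP => // wD; rewrite (wins_unique wD wC) eqxx in neqDC.
Qed.

End Winner.

(** * Elements called at two given positions *)

Section PairsOfPositions.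

Variables (E : finType) (p q : 'I_#|E|).

Lemma card_orders_at2 x y x' y' : x != y -> x' != y' ->
  #|[set s in orders E | (s p, s q) == (x, y)]|
    = #|[set s in orders E | (s p, s q) == (x', y')]|.
Proof.
(* The first transposition sends [x] to [x']; the second takes the image of [y] to [y'] and fixes
   [x']. *)
move=> neq_xy neq_xy'; pose f := (tperm x x' * tperm (tperm x x' y) y')%g.
have fy : f y = y' by rewrite permM tpermL.
have fx : f x = x'.
  rewrite permM tpermL tpermD //; last by rewrite eq_sym.
  by rewrite -[X in _ != X](tpermL x x') (inj_eq perm_inj) eq_sym.
rewrite -[RHS](card_relabel f); congr #|pred_of_set _|; apply/setP => s.
by rewrite !inE !ffunE -fx -fy !xpair_eqE !(inj_eq perm_inj).
Qed.

Lemma card_orders_at2_in : exists N, forall B : {set E * E},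
  (forall z, z \in B -> z.1 != z.2) ->
  #|[set s in orders E | (s p, s q) \in B]| = #|B| * N.
Proof.
(* Without any off-diagonal pair [B] is empty and every [N] would do; otherwise [N] is the count for
   one such pair, hence for all of them. *)
case: (pickP (fun z : E * E => z.1 != z.2)) => [z0 z0P | noz]; last first.
  exists 0 => B offB; suff -> : B = set0.
    by rewrite muln0; apply: eq_card0 => s; rewrite !inE andbF.
  by apply/setP => z; rewrite inE; apply/negP => /offB; rewrite noz.
exists #|[set s in orders E | (s p, s q) == z0]| => B offB.
rewrite -sum1dep_card (partition_big (fun s : {ffun _ -> _} => (s p, s q)) (mem B)).
  rewrite -sum_nat_const; apply: eq_bigr => -[x y] xyB.
  rewrite (_ : z0 = (z0.1, z0.2)); last by case: (z0).
  rewrite -(@card_orders_at2 x y) //; last exact: offB xyB.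
  rewrite -sum1dep_card; apply: eq_bigl => s.
  case: eqP => [->|]; last by rewrite !andbF.
  by have -> : (x, y) \in B := xyB; rewrite andbT.
by move=> s /andP[].
Qed.

Lemma card_offdiag (S : {set E}) :
  #|[set z : E * E | (z.1 \in S) && (z.2 \in S :\ z.1)]| = #|S| * #|S|.-1.
Proof.
rewrite -sum1dep_card -(pair_big_dep (mem S) (fun x y => y \in S :\ x) (fun _ _ => 1)).
rewrite -sum_nat_const /=; apply: eq_bigr => x xS.
by rewrite sum1_card (cardsD1 x S) xS.
Qed.

(** Cross-multiplied form of a probability. The same [N] serves for [S] and for the whole ground
    set, where the count is that of all orders. *)
Lemma card_orders_at2_set (S : {set E}) : p != q ->
  #|[set s in orders E | (s p \in S) && (s q \in S)]| * (#|E| * #|E|.-1)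
    = #|orders E| * (#|S| * #|S|.-1).
Proof.
move=> neq_pq; have [N cardN] := card_orders_at2_in.
have count (R : {set E}) :
    #|[set s in orders E | (s p \in R) && (s q \in R)]| = #|R| * #|R|.-1 * N.
  rewrite -card_offdiag -cardN => [|z]; last first.
    by rewrite !inE eq_sym => /and3P[].
  apply: eq_card => s; rewrite !inE; case: injectiveP => //= s_inj.
  by rewrite (inj_eq s_inj) eq_sym neq_pq.
have -> : #|orders E| = #|E| * #|E|.-1 * N.
  have := count setT; rewrite cardsT => <-; apply: eq_card => s.
  by rewrite [RHS]in_set !in_setT !andbT.
by rewrite count mulnC [in LHS](mulnC _ N) mulnA.
Qed.

End PairsOfPositions.

(** * Direct sums of two uniform matroids *)

Section TwoUniform.

Variables (E : finType) (S : {set E}) (a b : nat).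

Let I : {set {set E}} :=
  [set A : {set E} | (#|A :&: S| <= a) && (#|A :&: ~: S| <= b)].

Fact two_uniform_indep0 : set0 \in I.
Proof. by rewrite inE !set0I cards0. Qed.

Fact two_uniform_indepS (A B : {set E}) : A \subset B -> B \in I -> A \in I.
Proof.
rewrite !inE => sAB /andP[leB leB']; apply/andP; split.
  exact: leq_trans (subset_leq_card (setSI _ sAB)) leB.
exact: leq_trans (subset_leq_card (setSI _ sAB)) leB'.
Qed.

Fact two_uniform_indep_aug (A B : {set E}) :
  A \in I -> B \in I -> #|A| < #|B| -> exists2 x, x \in B :\: A & x |: A \in I.
Proof.
(* The smaller set has the smaller trace on some block [R]; adding a point of [B] from that block
   keeps the trace within that of [B] and leaves the other block alone. *)
have aug (R : {set E}) : #|A :&: R| < #|B :&: R| ->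
    exists2 x, x \in B :\: A & [/\ x \in R, #|(x |: A) :&: R| <= #|B :&: R|
      & (x |: A) :&: ~: R = A :&: ~: R].
  move=> ltAB; have /subsetPn[x] : ~~ (B :&: R \subset A :&: R).
    by apply: contraTN ltAB => /subset_leq_card; rewrite -leqNgt.
  rewrite !inE => /andP[xB xR]; rewrite xR andbT => xA.
  exists x; first by rewrite inE xA.
  split=> //; last first.
    by apply/setP => y; rewrite !inE; case: eqP => // ->; rewrite xR !andbF.
  apply: leq_trans ltAB; rewrite setIUl (setIidPl _) ?sub1set //.
  by rewrite cardsU1; case: (_ \notin _).
have split (R : {set E}) : #|R| = #|R :&: S| + #|R :&: ~: S|.
  by rewrite -setDE cardsID.
rewrite !inE [#|A|]split [#|B|]split.
move=> /andP[leA leA'] /andP[leB leB'] ltAB.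
have [/aug[x xBA [_ lex eqx]]|leBA] := ltnP #|A :&: S| #|B :&: S|.
  by exists x; rewrite // inE eqx leA' (leq_trans lex).
have /aug[x xBA [_ lex]] : #|A :&: ~: S| < #|B :&: ~: S|.
  rewrite ltnNge; apply: contraL ltAB => leBA'; rewrite -leqNgt; exact: leq_add.
by rewrite setCK => eqx; exists x; rewrite // inE eqx leA (leq_trans lex).
Qed.

Definition two_uniform : matroid E :=
  Matroid two_uniform_indep0 two_uniform_indepS two_uniform_indep_aug.

(** A circuit exceeds the bound in some block. Deleting a point off that block would leave the
    excess, so the circuit lies inside it. *)
Lemma circuits_two_uniform C : (C \in circuits two_uniform) =
  (C \subset S) && (#|C| == a.+1) || (C \subset ~: S) && (#|C| == b.+1).
Proof.
have only (R : {set E}) k : k < #|C :&: R| ->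
    (forall x, x \in C -> #|(C :\ x) :&: R| <= k) -> (C \subset R) && (#|C| == k.+1).
  move=> ltk lek; have sCR : C \subset R.
    apply/subsetP => x xC; apply: contraLR (lek x xC) => xR; rewrite -ltnNge.
    suff -> : (C :\ x) :&: R = C :&: R by [].
    by apply/setP => y; rewrite !inE; case: eqP => // ->; rewrite (negPf xR) !andbF.
  rewrite sCR eqn_leq; rewrite (setIidPl sCR) in ltk; rewrite ltk andbT.
  have /card_gt0P[x xC] : 0 < #|C| := leq_ltn_trans (leq0n k) ltk.
  have := lek x xC; rewrite [#|C|](cardsD1 x) xC (setIidPl _) //.
  exact: subset_trans (subD1set _ _) sCR.
have card_D1 (R : {set E}) k x : #|C| == k.+1 -> x \in C -> #|(C :\ x) :&: R| <= k.
  move=> /eqP cardC xC; apply: leq_trans (subset_leq_card (subsetIl _ _)) _.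
  by have := cardC; rewrite (cardsD1 x) xC => -[<-].
have disj (R A : {set E}) : A \subset R -> A :&: ~: R = set0.
  by move=> sAR; apply/eqP; rewrite setI_eq0 -subsets_disjoint.
apply/circuitP/orP => [[] | [] /andP[sC cardC]].
- rewrite inE negb_and -!ltnNge => dC minC.
  case/orP: dC => ltC; [left | right]; apply: only => // x /minC.
    by rewrite inE => /andP[].
  by rewrite inE => /andP[].
- split=> [|x xC]; rewrite inE; first by rewrite (setIidPl sC) (eqP cardC) ltnn.
  by rewrite card_D1 // disj ?cards0 // (subset_trans (subD1set _ _)).
split=> [|x xC]; rewrite inE; first by rewrite (setIidPl sC) (eqP cardC) ltnn andbF.
rewrite andbC card_D1 // -[S]setCK disj ?cards0 //.
exact: subset_trans (subD1set _ _) sC.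
Qed.

Lemma two_uniform_automorphism (f : {perm E}) :
  f @: S = S -> automorphism two_uniform f.
Proof.
move=> fS; apply: indep_automorphism => A.
have f_inj : injective f := @perm_inj _ f.
have cardI (R : {set E}) : #|(f @: A) :&: (f @: R)| = #|A :&: R|.
  by rewrite -imsetI ?card_imset //; apply: in2W.
by rewrite !inE -(cardI S) -(cardI (~: S)) imset_permC fS.
Qed.

End TwoUniform.

(** * An equitable matroid that is not circuit-transitive *)

Section NonTransitiveExample.

Variables (E : finType) (S : {set E}) (a b : nat).
Hypotheses (cardS : #|S| = a.+2) (cardSC : #|~: S| = b.+1).

Let M := two_uniform S a b.

Fact card_setD1 x : x \in S -> #|S :\ x| = a.+1.
Proof. by move=> xS; have := cardS; rewrite (cardsD1 x) xS => -[]. Qed.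

Fact circuit_setC : ~: S \in circuits M.
Proof. by rewrite circuits_two_uniform subxx cardSC eqxx orbT. Qed.

Fact circuit_setD1 x : x \in S -> S :\ x \in circuits M.
Proof.
by move=> xS; rewrite circuits_two_uniform subD1set card_setD1 ?eqxx.
Qed.

Fact circuits_example : circuits M = ~: S |: [set S :\ x | x in S].
Proof.
apply/setP => C; apply/idP/setU1P => [|[->|/imsetP[x xS ->]]]; last 2 first.
- exact: circuit_setC.
- exact: circuit_setD1.
rewrite circuits_two_uniform => /orP[] /andP[sC /eqP cardC]; [right | left].
  have /subsetPn[x xS xC] : ~~ (S \subset C).
    by apply/negP => /subset_leq_card; rewrite cardS cardC ltnn.
  apply/imsetP; exists x => //; apply/eqP; rewrite eqEcard subsetD1 sC xC.
  by rewrite card_setD1 ?cardC /=.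
by apply/eqP; rewrite eqEcard sC cardC cardSC leqnn.
Qed.

(* [~: S] needs [b.+1] calls and a competitor only [a.+1] of the [a.+2]
   elements of [S], so [~: S] comes first iff two elements of [S] are left
   over at its completion. *)
Lemma wins_setC (p q : 'I_#|E|) (s : {ffun 'I_#|E| -> E}) :
  p.+2 = #|E| -> q.+1 = #|E| -> s \in orders E ->
  wins M s (~: S) = (s p \in S) && (s q \in S).
Proof.
move=> pE qE sE; have s_inj : injective s by move: sE; rewrite inE => /injectiveP.
have qp : q = p.+1 :> nat by apply: succn_inj; rewrite qE pE.
have s_surj x : exists i, x = s i.
  have /codomP[i ->] : x \in codom s by apply: inj_card_onto; rewrite ?card_ord.
  by exists i.
have mem_called i t : (s i \in called s t) = (i < t).
  by rewrite mem_imset // inE.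
have lt_p (i : 'I_#|E|) : i != q -> i != p -> i < p.
  rewrite -!(inj_eq val_inj) /= qp => /negPf neq_iq /negPf neq_ip.
  have : i < p.+2 by rewrite pE.
  by rewrite ltnS leq_eqVlt neq_iq ltnS leq_eqVlt neq_ip.
apply/idP/andP => [/existsP[t /and3P[_ sT /forall_inP noC]] | [pS qS]].
  have p_or_q (i : 'I_#|E|) : s i \notin S -> i <= t.
    by move=> iS; rewrite -ltnS -mem_called (subsetP sT) // inE.
  have qS : s q \in S.
    (* If the last call is off [S], then all other elements, and with them all of [S], were called
       before the winning round. *)
    apply: contraT => qS; have /card_gt0P[x xS] : 0 < #|S| by rewrite cardS.
    have /negP[] := noC _ (circuit_setD1 xS).
    apply/subsetP => y; have [i ->] := s_surj y; rewrite !inE mem_called => /andP[_ iS].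
    apply: leq_trans (p_or_q q qS); rewrite ltn_neqAle -ltnS qE ltn_ord andbT.
    by rewrite (inj_eq val_inj); apply: contraNneq qS => <-.
  (* Likewise, if the call at [p] is off [S], then all of [S] except [s q] was called earlier, and
     this is a circuit. *)
  split=> //; apply: contraT => pS; have /negP[] := noC _ (circuit_setD1 qS).
  apply/subsetP => y; have [i ->] := s_surj y.
  rewrite !inE mem_called (inj_eq s_inj) => /andP[neq_iq iS].
  apply: leq_trans (p_or_q p pS); apply: lt_p => //.
  by apply: contraNneq pS => <-.
(* Some circuit wins. If it is [S :\ x], it contains one of the last two calls, so everything before
   position [p], including [~: S], was called before the winning round, a contradiction. *)
have [|C wC] := @wins_exists _ M s sE.
  by apply/set0Pn; exists (~: S); apply: circuit_setC.
have /existsP[t /and3P[cC sC /forall_inP noC]] := wC.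
move: (cC); rewrite circuits_example => /setU1P[<- // | /imsetP[x xS defC]].
have /negP[] := noC _ circuit_setC.
have le_pt : p <= t.
  have [xq|neq_xq] := eqVneq x (s q); rewrite -ltnS.
    rewrite -mem_called (subsetP sC) // defC !inE pS xq (inj_eq s_inj) andbT.
    by apply/eqP => /(congr1 val)/eqP; rewrite /= qp -[X in X == _]addn0 -addn1 eqn_add2l.
  apply: (@ltn_trans q); first by rewrite qp.
  by rewrite -mem_called (subsetP sC) // defC !inE qS eq_sym neq_xq.
apply/subsetP => y; have [i ->] := s_surj y; rewrite inE mem_called => iS.
by apply: leq_trans le_pt; apply: lt_p; apply: contraNneq iS => ->.
Qed.

Lemma card_wins_setC :
  #|[set s in orders E | wins M s (~: S)]| * (#|E| * #|E|.-1)
    = #|orders E| * (a.+2 * a.+1).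
Proof.
have cardE : #|E| = (a + b).+3 by rewrite -(cardsC S) cardS cardSC addnS.
(* Positions count from 0, so these are the last two of [a + b + 3]. *)
have pE : (a + b).+1 < #|E| by rewrite cardE.
have qE : (a + b).+2 < #|E| by rewrite cardE.
have := @card_orders_at2_set _ (Ordinal pE) (Ordinal qE) S.
rewrite cardS => <-; last by rewrite -(inj_eq val_inj) neq_ltn ltnS leqnn.
congr (_ * _); apply: eq_card => s; rewrite !inE.
case: injectiveP => //= s_inj; apply: wins_setC; rewrite ?cardE //.
by rewrite inE; apply/injectiveP.
Qed.

Lemma card_wins_setD1 x y : x \in S -> y \in S ->
  #|[set s in orders E | wins M s (S :\ x)]|
    = #|[set s in orders E | wins M s (S :\ y)]|.
Proof.
move=> xS yS; have [-> // | neq_xy] := eqVneq x y.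
have -> : S :\ x = tperm x y @: (S :\ y).
  rewrite tperm_imset ?inE ?eqxx ?neq_xy //; apply/setP => z; rewrite !inE.
  by have [->|//] := eqVneq z y; rewrite eq_sym neq_xy yS.
rewrite card_wins_automorphism //; apply: two_uniform_automorphism.
apply/eqP; rewrite eqEcard card_imset ?leqnn ?andbT; last exact: perm_inj.
by apply/subsetP => _ /imsetP[z zS ->]; case: tpermP.
Qed.

(** There are [a.+3] circuits, and the hypothesis says that [~: S] wins with probability one in
    [a.+3]. The other [a.+2] circuits have equal counts, so each gets the same share. *)
Lemma two_uniform_equitable : #|E| * #|E|.-1 = a.+3 * (a.+2 * a.+1) ->
  equitable M.
Proof.
move=> cardE; set W := fun C => #|[set s in orders E | wins M s C]|.
have eqW : forall x, x \in S -> W (S :\ x) = W (~: S).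
  move=> x xS.
  have c0 : circuits M != set0 by apply/set0Pn; exists (~: S); apply: circuit_setC.
  have WT : #|orders E| = a.+3 * W (~: S).
    have := card_wins_setC; rewrite -/(W _) cardE mulnA => /eqP.
    by rewrite eqn_pmul2r // mulnC => /eqP.
  (* To split off [~: S] from the sum, it must differ from every [S :\ y], which is nonempty and
     inside [S]. *)
  have := sum_wins c0; rewrite circuits_example big_setU1 /=; last first.
    apply/imsetP => -[y yS /setP eqS].
    have /card_gt0P[z zSy] : 0 < #|S :\ y| by rewrite card_setD1.
    by have := zSy; rewrite -eqS inE; case/setD1P: zSy => _ ->.

  rewrite big_imset /=; last first.
    move=> y z yS zS /setP/(_ y); rewrite !inE eqxx yS andbT.
    by case: eqP.

  rewrite (eq_bigr (fun _ => W (S :\ x))) => [|y yS]; last exact: card_wins_setD1.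
  rewrite sum_nat_const cardS WT [a.+3 * _]mulSn => /eqP.
  by rewrite eqn_add2l eqn_pmul2l // => /eqP.
have {}eqW C : C \in circuits M -> W C = W (~: S).
  by rewrite circuits_example => /setU1P[->|/imsetP[x xS ->]] //; apply: eqW.
by move=> C D cC cD; rewrite /beta -/(W C) -/(W D) !eqW.
Qed.

(** A permutation preserves sizes, and the two kinds of circuit have sizes [a.+1] and [b.+1]. *)
Lemma two_uniform_not_transitive : a != b -> ~ circuit_transitive M.
Proof.
move=> neq_ab; have /card_gt0P[x xS] : 0 < #|S| by rewrite cardS.
case/(_ _ _ (circuit_setD1 xS) circuit_setC) => f _ fC.
have := cardSC; rewrite -fC card_imset ?card_setD1 //; last exact: perm_inj.
by case=> eq_ab; rewrite eq_ab eqxx in neq_ab.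
Qed.

End NonTransitiveExample.

Lemma exists_equitable_not_transitive : exists (E : finType) (M : matroid E),
  equitable M /\ ~ circuit_transitive M.
Proof.
(* The required equation becomes 15 * 14 = 7 * 6 * 5 for [a] = 4; then [b] = 8, because the ground
   set has [a + b + 3] elements. *)
pose S := [set i : 'I_15 | i < 6].
have cardS : #|S| = 6.
  by rewrite -sum1dep_card big_mkcond !big_ord_recl big_ord0.
have cardSC : #|~: S| = 9 by rewrite cardsCs setCK card_ord cardS.
exists 'I_15, (two_uniform S 4 8); split.
  by apply: (two_uniform_equitable cardS cardSC); rewrite card_ord.
exact: (two_uniform_not_transitive cardS cardSC).
Qed.

Theorem theorem9 :
  (* (1) *)
  (forall (E : finType) (M : matroid E),
     (forall C1 C2 : {set E}, C1 \in circuits M -> C2 \in circuits M ->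
        (exists2 f : {perm E}, automorphism M f & f @: C1 = C2) ->
        beta M C1 = beta M C2)
     /\ (circuit_transitive M -> equitable M))
  /\
  (* (2) *)
  (exists (E : finType) (M : matroid E),
     equitable M /\ ~ circuit_transitive M)
  /\
  (* (3) *)
  ((forall r n : nat, equitable (uniform r n))
   /\ (forall (n : nat) (F : finFieldType), equitable (dual (PG n F)))).
Proof.
split=> [E M | ].
  split=> [C _ _ _ [f autf <-] | ]; last exact: circuit_transitive_equitable.
  by rewrite /beta card_wins_automorphism.
split; first exact: exists_equitable_not_transitive.
split=> [r n | n F]; apply: circuit_transitive_equitable.
  exact: uniform_circuit_transitive.
exact: dual_PG_circuit_transitive.
Qed.
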